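(* For every integer $n\ge 3$, the graph $\Gamma(D_n)$ is not a cluster graph.
   Context: For a finite group $G$, the co-maximal subgroup graph $\Gamma(G)$ is the simple undirected graph whose vertices are the non-trivial proper subgroups of $G$, two distinct vertices $H,K$ being adjacent if and only if $HK=G$, where $HK=\{hk: h\in H, k\in K\}$. $D_n=\langle r,s: r^n=s^2=1,\ srs^{-1}=r^{-1}\rangle$ is the dihedral group of order $2n$. A graph is a cluster graph if it has no induced subgraph isomorphic to $P_3$, the path on $3$ vertices. *)

(* Defs.v *)
From mathcomp Require Import all_boot all_fingroup all_solvable.

Set Implicit Arguments.
Unset Strict Implicit.
Unset Printing Implicit Defensive.

Local Open Scope group_scope.

Record sgraph := SGraph {
  vertex : finType;
  adj : rel vertex;
  adj_sym : symmetric adj;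
  adj_irr : irreflexive adj }.

Definition graph_iso (X Y : sgraph) : Prop :=
  exists f : vertex X -> vertex Y,
    bijective f /\ forall x y, adj (f x) (f y) = adj x y.

Section Induced.

Variables (X : sgraph) (S : {set vertex X}).

Definition induced_adj : rel {x | x \in S} := fun x y => adj (val x) (val y).

Lemma induced_adj_sym : symmetric induced_adj.
Proof. by move=> x y; apply: adj_sym. Qed.

Lemma induced_adj_irr : irreflexive induced_adj.
Proof. by move=> x; apply: adj_irr. Qed.

Definition induced : sgraph := SGraph induced_adj_sym induced_adj_irr.

End Induced.

Section Path.

Variable n : nat.

Definition path_adj : rel 'I_n := fun i j => (i.+1 == j) || (j.+1 == i).

Lemma path_adj_sym : symmetric path_adj.
Proof. by move=> i j; rewrite /path_adj orbC. Qed.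

Lemma path_adj_irr : irreflexive path_adj.
Proof. by move=> i; rewrite /path_adj orbb gtn_eqF. Qed.

(* The path on n vertices (not n edges). *)
Definition path_graph : sgraph := SGraph path_adj_sym path_adj_irr.

End Path.

Definition cluster_graph (X : sgraph) : Prop :=
  ~ exists S : {set vertex X}, graph_iso (induced S) (path_graph 3).

Section ComaximalSubgroupGraph.

Variables (gT : finGroupType) (G : {group gT}).

Definition comax_vertex : finType :=
  {H : {group gT} | (H :!=: 1) && (H \proper G)}.

(* The product is the setwise product, not the generated subgroup. *)
Definition comax_adj : rel comax_vertex :=
  fun H K => (H != K) && (val H * val K == G :> {set gT}).

Lemma comax_adj_sym : symmetric comax_adj.
Proof.
move=> H K; rewrite /comax_adj eq_sym; congr andb.
by apply/eqP/eqP=> /(congr1 (fun A : {set gT} => A^-1)); rewrite invMg !invGid.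
Qed.

Lemma comax_adj_irr : irreflexive comax_adj.
Proof. by move=> H; rewrite /comax_adj eqxx. Qed.

Definition comax_graph : sgraph := SGraph comax_adj_sym comax_adj_irr.

End ComaximalSubgroupGraph.

(* The library indexes dihedral groups by their order: 'D_m has order m. *)
Definition dihedral (n : nat) : {group 'D_(n.*2)} := [set: 'D_(n.*2)]%G.

Lemma dihedral_card n : 1 < n -> #|dihedral n| = n.*2.
Proof. by move=> n_gt1; rewrite (@card_dihedral n) ?mul2n. Qed.

Lemma dihedral_presentation n : 1 < n ->
  dihedral n \isog Grp (r : s : r ^+ n, s ^+ 2, s * r * s^-1 = r^-1).
Proof.
move=> n_gt1 rT H; rewrite (@Grp_dihedral n) ?mul2n //.
apply/existsP/existsP=> -[[r s]] /=; rewrite !xpair_eqE /=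
  => /and4P[defH rn s2 rs]; exists (r, s); rewrite /= !xpair_eqE /=.
- rewrite defH rn s2 /=; have Vs: s^-1 = s by apply/eqP; rewrite eq_invg_mul.
  by rewrite -(eqP rs) conjgE mulgA Vs.
rewrite defH rn s2 /=; have Vs: s^-1 = s by apply/eqP; rewrite eq_invg_mul.
by rewrite -(eqP rs) conjgE mulgA Vs.
Qed.

(* Main.v *)
Require Import Defs.
From mathcomp Require Import all_boot all_fingroup all_solvable.

(** The cyclic group H = <r> of rotations has index 2 in the dihedral group G
    of order 2n, and the reflections s and sr are distinct involutions outside
    H. A subgroup of index 2 is comaximal with any subgroup not contained in
    it, so <s> and <sr> are both adjacent to H; they are not adjacent to each
    other, because their product has at most 4 elements while G has 2n >= 6.
    Thus <s>, H, <sr> induce a path on three vertices ([index2_not_cluster]).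
    The rotation r is extracted from the presentation of G
    ([dihedral_rotation]), its exact order being forced by the order of G. *)

Local Open Scope group_scope.

(** Three vertices spanning exactly the edges ab and bc induce a path. *)
Lemma induced_P3_not_cluster (X : sgraph) (a b c : vertex X) :
  adj a b -> adj b c -> a != c -> ~~ adj a c -> ~ cluster_graph X.
Proof.
move=> ab bc ac nac; apply; exists [set a; b; c].
have ab' : a != b by apply: contraTneq ab => ->; rewrite adj_irr.
have bc' : b != c by apply: contraTneq bc => ->; rewrite adj_irr.
pose f (u : vertex (induced [set a; b; c])) : vertex (path_graph 3) :=
  if val u == a then inord 0 else if val u == b then inord 1 else inord 2.
have ba := negPf ab'; have cb := negPf bc'; have ca := negPf ac.
rewrite eq_sym in ba; rewrite eq_sym in cb; rewrite eq_sym in ca.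
have fadj x y : adj (f x) (f y) = adj x y.
  case: x y => [x xS] [y yS]; rewrite /f /= /induced_adj /path_adj /=.
  move: (xS) (yS); rewrite !inE -!orbA.
  by case/or3P=> /eqP-> /or3P[]/eqP->;
    rewrite ?eqxx ?ba ?cb ?ca ?inordK //= ?adj_irr ?ab ?bc ?(negPf nac) //
    adj_sym ?ab ?bc ?(negPf nac).
exists f; split=> //; apply: inj_card_bij.
  move=> [x xS] [y yS] fxy; apply: val_inj => /=.
  move: (congr1 val fxy); rewrite /f /=; move: (xS) (yS); rewrite !inE -!orbA.
  by case/or3P=> /eqP-> /or3P[]/eqP->; rewrite ?eqxx ?ba ?cb ?ca ?inordK.
rewrite card_ord card_sig (eq_card (B := mem [set a; b; c])) //.
by rewrite -setUA cardsU1 cards2 !inE negb_or ab' ac bc'.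
Qed.

(** A subgroup of index 2 is both normal and maximal, hence comaximal with any
    cyclic group it does not contain. *)
Lemma index2_mul_cycle {gT : finGroupType} (G H : {group gT}) (x : gT) :
  H \subset G -> #|G : H| = 2 -> x \in G -> x \notin H -> H * <[x]> = G.
Proof.
move=> sHG iHG xG xH; apply: mulg_normal_maximal; rewrite ?cycle_subG //.
  exact: index2_normal.
by apply: p_index_maximal; rewrite ?iHG.
Qed.

Lemma index2_not_cluster {gT : finGroupType} (G H : {group gT}) (x y : gT) :
    H \subset G -> #|G : H| = 2 -> 4 < #|G| ->
    x \in G -> x \notin H -> #[x] = 2 -> y \in G -> y \notin H -> #[y] = 2 ->
  x != y -> ~ cluster_graph (comax_graph G).
Proof.
move=> sHG iHG G4 xG xH ox yG yH oy xy.
have cardH : (#|H| * 2 = #|G|)%N by rewrite -iHG Lagrange.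
have vH : (H :!=: 1) && (H \proper G).
  rewrite properEneq sHG andbT; apply/andP; split.
    by apply: contraTneq G4 => H1; rewrite -cardH H1 cards1.
  by apply: contraNneq xH => ->.
have vC z : z \in G -> #[z] = 2 -> (<[z]>%G :!=: 1) && (<[z]>%G \proper G).
  move=> zG oz; rewrite /= cycle_eq1 -order_gt1 oz /= properEcard cycle_subG zG.
  by rewrite -orderE oz (ltn_trans _ G4).
pose vertexC z zG oz : vertex (comax_graph G) :=
    Sub <[z]>%G (vC z zG oz).
pose b : vertex (comax_graph G) := Sub H vH.
have adjC z zG oz : z \notin H -> adj (vertexC z zG oz) b.
  move=> zH; rewrite adj_sym /= /comax_adj /= (index2_mul_cycle G) // eqxx andbT.
  by apply: contraNneq zH => /(congr1 val) /= ->; apply: cycle_id.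
apply: (@induced_P3_not_cluster _ (vertexC x xG ox) b (vertexC y yG oy)).
- exact: adjC.
- by rewrite adj_sym; apply: adjC.
- apply: contraNneq xy => /(congr1 (fun u => gval (val u))) /= exy.
  (* A group of order 2 has a single nontrivial element. *)
  have : x \in <[y]> by rewrite -exy cycle_id.
  rewrite cycle2g // !inE => /orP[/eqP x1 | //].
  by move: ox; rewrite x1 order1.
(* |<x><y>| divides |<x>||<y>| = 4. *)
apply/negP => /andP[_ /eqP /= eG]; have := mul_cardG <[x]> <[y]>.
rewrite eG -!orderE ox oy => /= e.
by move: G4; rewrite ltnNge -[4]/(2 * 2)%N e leq_pmulr // cardG_gt0.
Qed.

(** The relations only bound the orders of r and s from above; that r has order
    exactly n and that s is not a rotation come from G = <r><s> having order
    2n. *)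
Lemma dihedral_rotation (n : nat) : 1 < n ->
  exists r s : 'D_(n.*2),
    [/\ #[r] = n, s \notin <[r]>, s ^+ 2 = 1 & r ^ s = r^-1].
Proof.
move=> n1; have isoG := @Grp_dihedral n n1.
move: (isoG _ (dihedral n)).
rewrite homg_refl => /esym/existsP[[r s]] /=.
rewrite !xpair_eqE => /and4P[/eqP defG /eqP rn /eqP s2 /eqP rs].
have cardG := dihedral_card n1; rewrite /= in defG.
have nrs : <[s]> \subset 'N(<[r]>).
  by rewrite cycle_subG; apply/normP; rewrite -cycleJ rs cycleV.
have le_s : #[s] <= 2 by rewrite dvdn_leq // order_dvdn s2.
have prodG : <[r]> * <[s]> = dihedral n by rewrite -norm_joinEr.
have le_n : n <= #[r].
  have le_G : #|dihedral n| <= #[r] * 2.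
    apply: leq_trans (leq_mul (leqnn _) le_s).
    by rewrite !orderE mul_cardG prodG leq_pmulr // cardG_gt0.
  by rewrite cardG muln2 leq_double in le_G.
have or : #[r] = n.
  apply/eqP; rewrite eqn_leq le_n andbT dvdn_leq ?order_dvdn ?rn //.
  exact: ltnW.
exists r, s; split=> //; apply/negP => sr.
have : #|dihedral n| = n by rewrite -prodG mulGSid ?cycle_subG // -orderE or.
rewrite cardG -addnn => /eqP; rewrite -[X in _ == X]addn0 eqn_add2l => /eqP n0.
by rewrite n0 in n1.
Qed.

Theorem theorem2p2 (n : nat) (hn : 3 <= n) :
  ~ cluster_graph (comax_graph (dihedral n)).
Proof.
have n1 : 1 < n by apply: ltn_trans hn.
have [r [s [or sr s2 rs]]] := dihedral_rotation n n1.
have cardG := dihedral_card n1.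
have involution z : z \notin <[r]> -> z ^+ 2 = 1 -> #[z] = 2.
  by move=> zr z2; apply: nt_prime_order => //; apply: contraNneq zr => ->.
have srr : s * r \notin <[r]> by rewrite groupMr ?cycle_id.
have srV : (s * r) ^+ 2 = 1.
  have Vs : s^-1 = s by apply/eqP; rewrite eq_invg_mul -expg2 s2.
  have srs : s * r * s = r ^ s by rewrite conjgE Vs mulgA.
  by rewrite expg2 mulgA srs rs mulVg.
apply: (@index2_not_cluster _ _ <[r]>%G s (s * r)).
all: rewrite ?inE ?subsetT //; try exact: involution.
- by rewrite -divgS ?subsetT // cardG -orderE or -mul2n mulnK // ltnW.
- by rewrite cardG (leq_trans (_ : 4 < 3.*2)) // leq_double.
apply/eqP => /eqP; rewrite eq_sym -{2}[s]mulg1 (inj_eq (mulgI s)) => r1.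
by move: hn; rewrite -or (eqP r1) order1.
Qed.
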